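(* Let $I_1,I_2\subset\mathbb{R}$ be intervals, let $\alpha:I_1\to\mathbb{R}^2$ and $\beta:I_2\to\mathbb{R}^2$ be $C^\infty$ plane curves, and let $q=(\mathbf{x},g):I_1\times I_2\to\mathbb{R}^3$ be the generalized area distance of the pair $(\alpha,\beta)$. Then $q$ fails to be an immersion at $(s,t)$ exactly when $[\alpha'(s),\beta'(t)]=0$. On the open set $\{(s,t):[\alpha'(s),\beta'(t)]\neq 0\}$, $q$ is an improper indefinite affine sphere: $(s,t)$ are asymptotic coordinates with $LN-M^2<0$, and the affine normal (for the appropriate choice of sign) is the constant vector field $\xi=(0,0,1)$.
   Context: For vectors, $[\cdot,\cdot]$ (in $\mathbb{R}^2$) and $[\cdot,\cdot,\cdot]$ (in $\mathbb{R}^3$) denote determinants, and $(a,b)^\perp=(-b,a)$ is anticlockwise rotation by ninety degrees. Subscripts $s,t$ denote partial derivatives. Generalized area distance: for $C^\infty$ plane curves $\alpha(s)$, $s\in I_1$, and $\beta(t)$, $t\in I_2$, put $\mathbf{x}(s,t)=\frac12(\alpha(s)+\beta(t))$ and $\mathbf{n}(s,t)=\frac12(\beta(t)-\alpha(s))^{\perp}$. Let $g:I_1\times I_2\to\mathbb{R}$ be the function, unique up to an additive constant, with $\nabla g=\mathbf{n}$, the gradient being taken with respect to $\mathbf{x}$; that is, $g_s=\mathbf{n}\cdot\mathbf{x}_s$ and $g_t=\mathbf{n}\cdot\mathbf{x}_t$. The map $q(s,t)=(\mathbf{x}(s,t),g(s,t))$ is the generalized area distance of $(\alpha,\beta)$.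 Affine normal: for an immersion $q(s,t)$ into $\mathbb{R}^3$ write $L=[q_s,q_t,q_{ss}]$, $M=[q_s,q_t,q_{st}]$, $N=[q_s,q_t,q_{tt}]$. The immersion is indefinite (non-convex) if $LN-M^2<0$; $(s,t)$ are asymptotic coordinates if $L=N=0$. In asymptotic coordinates, the affine normal is $\xi=q_{st}/\Omega$, where $\Omega$ is smooth with $\Omega^2=|M|$; it is defined up to sign (on each connected component of the domain), the sign corresponding to the choice of orientation. An immersion is an improper affine sphere if $\xi$ is a constant vector field. *)

(* Defs.v *)
From HB Require Import structures.
From mathcomp Require Import all_boot all_order all_algebra.
From mathcomp Require Import all_classical all_reals all_analysis.

Set Implicit Arguments.
Unset Strict Implicit.
Unset Printing Implicit Defensive.

Import Order.TTheory GRing.Theory Num.Theory.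
Import numFieldNormedType.Exports.

Local Open Scope classical_set_scope.
Local Open Scope ring_scope.

(* The intervals may contain endpoints, so derivatives are taken relative to a
   set: the increment h is restricted to those with h + x in A.  When A is a
   neighborhood of x these are the library's derivable f x 1 and f^`() x; at an
   endpoint of an interval A they are one-sided.  They are meaningful only when
   x is not isolated in A, since otherwise the filter is improper. *)
Definition derivable1_within (R : realType) (V : normedModType R)
    (A : set R) (f : R -> V) (x : R) : Prop :=
  cvg ((fun h : R => h^-1 *: (f (h + x) - f x))
         @ within [set h | A (h + x)] 0^').

Definition derive1_within (R : realType) (V : normedModType R)
    (A : set R) (f : R -> V) (x : R) : V :=
  lim ((fun h : R => h^-1 *: (f (h + x) - f x))
         @ within [set h | A (h + x)] 0^').

Definition smooth_curve (R : realType) (V : normedModType R)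
    (I : set R) (f : R -> V) : Prop :=
  forall (n : nat) (x : R), I x ->
    derivable1_within I (iter n (derive1_within I) f) x.

(* Partial derivatives, in p = (s, t), of a map defined on A : set (R * R). *)
Definition derivable_s (R : realType) (V : normedModType R)
    (A : set (R * R)) (f : R * R -> V) (p : R * R) : Prop :=
  derivable1_within [set s | A (s, p.2)] (fun s => f (s, p.2)) p.1.

Definition derivable_t (R : realType) (V : normedModType R)
    (A : set (R * R)) (f : R * R -> V) (p : R * R) : Prop :=
  derivable1_within [set t | A (p.1, t)] (fun t => f (p.1, t)) p.2.

Definition partial_s (R : realType) (V : normedModType R)
    (A : set (R * R)) (f : R * R -> V) (p : R * R) : V :=
  derive1_within [set s | A (s, p.2)] (fun s => f (s, p.2)) p.1.

Definition partial_t (R : realType) (V : normedModType R)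
    (A : set (R * R)) (f : R * R -> V) (p : R * R) : V :=
  derive1_within [set t | A (p.1, t)] (fun t => f (p.1, t)) p.2.

(* The iterated partial derivative along a word w, read from right to left:
   false stands for the partial derivative in s, true for the one in t. *)
Definition iter_partial (R : realType) (V : normedModType R)
    (A : set (R * R)) (w : seq bool) (f : R * R -> V) : R * R -> V :=
  foldr (fun (b : bool) h => if b then partial_t A h else partial_s A h) f w.

(* C^infinity: all iterated partial derivatives, in every order, exist and are
   continuous on A. *)
Definition smooth_on (R : realType) (V : normedModType R)
    (A : set (R * R)) (f : R * R -> V) : Prop :=
  forall w : seq bool,
    {within A, continuous (iter_partial A w f)} /\
    forall p, A p -> derivable_s A (iter_partial A w f) p /\
                     derivable_t A (iter_partial A w f) p.

(* The vectors are the rows of the matrices. *)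
Definition det2 (R : realType) (u v : 'rV[R]_2) : R :=
  \det (\matrix_(i < 2) [:: u; v]`_i).

Definition det3 (R : realType) (u v w : 'rV[R]_3) : R :=
  \det (\matrix_(i < 3) [:: u; v; w]`_i).

Definition dot (R : realType) (u v : 'rV[R]_2) : R :=
  \sum_(i < 2) u 0 i * v 0 i.

Definition perp (R : realType) (u : 'rV[R]_2) : 'rV[R]_2 :=
  \row_(j < 2) [:: - u 0 1; u 0 0]`_j.

Definition midpoint (R : realType) (alpha beta : R -> 'rV[R]_2)
    (p : R * R) : 'rV[R]_2 :=
  2^-1 *: (alpha p.1 + beta p.2).

Definition half_chord_perp (R : realType) (alpha beta : R -> 'rV[R]_2)
    (p : R * R) : 'rV[R]_2 :=
  2^-1 *: perp (beta p.2 - alpha p.1).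

(* grad g = n with respect to x, that is, g_s = n . x_s and g_t = n . x_t. *)
Definition has_gradient_half_chord (R : realType) (D : set (R * R))
    (alpha beta : R -> 'rV[R]_2) (g : R * R -> R) : Prop :=
  forall p, D p ->
    [/\ derivable_s D g p,
        partial_s D g p =
          dot (half_chord_perp alpha beta p)
              (partial_s D (midpoint alpha beta) p),
        derivable_t D g p &
        partial_t D g p =
          dot (half_chord_perp alpha beta p)
              (partial_t D (midpoint alpha beta) p)].

Definition area_distance (R : realType) (alpha beta : R -> 'rV[R]_2)
    (g : R * R -> R) (p : R * R) : 'rV[R]_3 :=
  row_mx (midpoint alpha beta p) (g p)%:M : 'rV[R]_(2 + 1).

(* Injectivity of the differential (a, b) |-> a q_s + b q_t. *)
Definition immersion_at (R : realType) (A : set (R * R))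
    (q : R * R -> 'rV[R]_3) (p : R * R) : Prop :=
  injective (fun v : R * R =>
    v.1 *: partial_s A q p + v.2 *: partial_t A q p).

Definition immersion_on (R : realType) (A : set (R * R))
    (q : R * R -> 'rV[R]_3) : Prop :=
  smooth_on A q /\ forall p, A p -> immersion_at A q p.

Definition coefL (R : realType) (A : set (R * R))
    (q : R * R -> 'rV[R]_3) (p : R * R) : R :=
  det3 (partial_s A q p) (partial_t A q p) (partial_s A (partial_s A q) p).

Definition coefM (R : realType) (A : set (R * R))
    (q : R * R -> 'rV[R]_3) (p : R * R) : R :=
  det3 (partial_s A q p) (partial_t A q p) (partial_t A (partial_s A q) p).

Definition coefN (R : realType) (A : set (R * R))
    (q : R * R -> 'rV[R]_3) (p : R * R) : R :=
  det3 (partial_s A q p) (partial_t A q p) (partial_t A (partial_t A q) p).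

Definition indefinite_on (R : realType) (A : set (R * R))
    (q : R * R -> 'rV[R]_3) : Prop :=
  forall p, A p -> coefL A q p * coefN A q p - coefM A q p ^+ 2 < 0.

Definition asymptotic_on (R : realType) (A : set (R * R))
    (q : R * R -> 'rV[R]_3) : Prop :=
  forall p, A p -> coefL A q p = 0 /\ coefN A q p = 0.

(* xi is an affine normal field of q, for q indefinite and in asymptotic
   coordinates (so that M, hence Omega, does not vanish).  The smooth root
   Omega of |M| is determined up to a sign on each connected component of A;
   a choice of signs is a choice of Omega. *)
Definition affine_normal (R : realType) (A : set (R * R))
    (q : R * R -> 'rV[R]_3) (xi : R * R -> 'rV[R]_3) : Prop :=
  exists Omega : R * R -> R,
    smooth_on A Omega /\
    forall p, A p ->
      Omega p ^+ 2 = `|coefM A q p| /\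
      xi p = (Omega p)^-1 *: partial_t A (partial_s A q) p.

Definition improper_indefinite_affine_sphere (R : realType)
    (A : set (R * R)) (q : R * R -> 'rV[R]_3) : Prop :=
  [/\ immersion_on A q, indefinite_on A q, asymptotic_on A q &
      exists c : 'rV[R]_3, affine_normal A q (fun=> c)].

Definition vec001 (R : realType) : 'rV[R]_3 := \row_(j < 3) [:: 0; 0; 1]`_j.

Definition regular_set (R : realType) (I1 I2 : set R)
    (alpha beta : R -> 'rV[R]_2) : set (R * R) :=
  [set p | (I1 `*` I2) p /\
     det2 (derive1_within I1 alpha p.1) (derive1_within I2 beta p.2) != 0].

(* Main.v *)
Require Import Defs.
From mathcomp Require Import all_boot all_order all_algebra.
From mathcomp Require Import all_classical all_reals all_analysis.
From mathcomp Require Import ring lra.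
Import Order.TTheory GRing.Theory Num.Theory.
Import numFieldNormedType.Exports.
Local Open Scope classical_set_scope.
Local Open Scope ring_scope.

(** The proof rests on three explicit formulas.  Write [[u, v]] for the plane
    determinant, [chord = beta - alpha] and [n] for the rotated half chord.
    From [grad g = n] one gets [g_s = 4^-1 [chord, alpha']] and
    [g_t = 4^-1 [chord, beta']], so [q_s] and [q_t] are the vectors
    [(u / 2, n . u / 2)] for [u = alpha'] and [u = beta'] (lemmas [q_s], [q_t],
    [tangent]).  Since such a vector is determined by [u], linearly, the
    differential of [q] is injective exactly when [alpha'] and [beta'] are
    independent ([area_distance_immersionP]).

    Differentiating once more, the rotated vector [alpha'] that comes from [n]
    is orthogonal to [alpha'].  Hence [q_ss] and [q_tt] are again of the same
    form, with [u = alpha''] and [u = beta''], and stay in the tangent plane: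
    [L = N = 0].  The mixed derivative [q_st] is vertical with height
    [Omega = 4^-1 [beta', alpha']], because the midpoint separates the
    variables.  Expanding the determinant gives [M = - Omega ^ 2], which is
    negative on the regular set, and [q_st / Omega = (0, 0, 1)].

    The analytic work is the smoothness of [q].  The polynomials in [g] and in
    the derivatives of the curves form a family closed under partial
    derivatives, so it is enough that their members are continuous
    ([smooth_on_family], [jet_closed_under_partials]).  Only [g] needs an
    argument: its mixed second difference is that of [4^-1 [beta t, alpha s]]
    ([g_mixed_difference]), so [g] is that determinant plus a function of [s]
    plus a function of [t].

    The intervals may contain their endpoints, so derivatives are relative to
    a set.  The same computations serve on the whole rectangle and on the
    regular set, which is relatively open in it: relative derivatives restrict
    to smaller sets, and remain unique as long as no point is isolated in its
    slices ([thick_relatively_open]). *)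

(** * Derivatives relative to a subset of the line *)

(** By conversion, [P] belongs to this filter when
    [\forall h \near 0, h != 0 -> A (h + x) -> P h]; the proofs below pass
    between the two forms. *)
Definition increments {R : realType} (A : set R) (x : R) : set_system R :=
  within [set h | A (h + x)] 0^'.

(** [derive1_within] is a choice of limit, with no meaning where [x] is isolated
    in [A].  Computing with this relation confines that question to the moment
    when the value is read off ([has_derive_val]). *)
Definition has_derive {R : realType} {V : normedModType R} (A : set R)
    (f : R -> V) (x : R) (l : V) : Prop :=
  (fun h : R => h^-1 *: (f (h + x) - f x)) @ increments A x --> l.

Instance increments_filter {R : realType} (A : set R) (x : R) :
  Filter (increments A x).
Proof. exact: within_filter. Qed.

Section OneVariable.
Context {R : realType}.
Implicit Types (A B I : set R) (x : R).

Lemma has_derive_val {V : normedModType R} {A} {f : R -> V} {x l} :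
  ProperFilter (increments A x) -> has_derive A f x l ->
  derive1_within A f x = l.
Proof. by move=> pA; exact: (@norm_cvg_lim _ _ _ (fmap_proper_filter _ pA)). Qed.

Lemma has_derive_ex {V : normedModType R} {A} {f : R -> V} {x l} :
  has_derive A f x l -> derivable1_within A f x.
Proof. by move=> fl; apply/cvg_ex; exists l. Qed.

Lemma smooth_curve_has_derive {V : normedModType R} {I} {f : R -> V} n {x} :
  smooth_curve I f -> I x ->
  has_derive I (iter n (derive1_within I) f) x
    (iter n.+1 (derive1_within I) f x).
Proof. by move=> smooth_f Ix; exact: smooth_f. Qed.

Lemma has_derive_eq {V : normedModType R} {A} {f : R -> V} {x l m} :
  has_derive A f x l -> l = m -> has_derive A f x m.
Proof. by move=> fl <-. Qed.

Lemma has_derive_subset {V : normedModType R} {A B} {f : R -> V} {x l} :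
  A `<=` B -> has_derive B f x l -> has_derive A f x l.
Proof.
move=> AB fl P Pl.
have {}fl : \forall h \near (0 : R)^', B (h + x) ->
    P (h^-1 *: (f (h + x) - f x)) by exact: fl.
by apply: filterS fl => h Ph /AB.
Qed.

Lemma has_derive_eq_in {V : normedModType R} {A} {f f' : R -> V} {x l} :
  (forall y, A y -> f y = f' y) -> A x ->
  has_derive A f x l -> has_derive A f' x l.
Proof.
move=> ff' Ax; apply: cvg_trans; apply: near_eq_cvg.
by rewrite /increments near_withinE; apply: nearW => h /= Ah; rewrite !ff'.
Qed.

Lemma has_derive_cst {V : normedModType R} A (c : V) x :
  has_derive A (fun=> c) x 0.
Proof.
rewrite /has_derive (_ : (fun h : R => _) = fun=> 0); first exact: cvg_cst.
by apply/funext => h; rewrite subrr scaler0.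
Qed.

Lemma has_deriveD {V : normedModType R} {A} {f k : R -> V} {x l m} :
  has_derive A f x l -> has_derive A k x m ->
  has_derive A (fun y => f y + k y) x (l + m).
Proof.
move=> fl km; rewrite /has_derive.
rewrite (_ : (fun h : R => _) = (fun h : R => h^-1 *: (f (h + x) - f x)) +
    (fun h : R => h^-1 *: (k (h + x) - k x))); first exact: cvgD.
by apply/funext => h; rewrite fctE -scalerDr opprD addrACA.
Qed.

Lemma has_deriveZ {V : normedModType R} (c : R) {A} {f : R -> V} {x l} :
  has_derive A f x l -> has_derive A (fun y => c *: f y) x (c *: l).
Proof.
move=> fl; rewrite /has_derive.
rewrite (_ : (fun h : R => _) = c \*: (fun h : R => h^-1 *: (f (h + x) - f x))).
  exact: cvgZl_tmp.
by apply/funext => h /=; rewrite -scalerBr !scalerA mulrC.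
Qed.

Lemma has_derive_increments {V : normedModType R} {A} {f : R -> V} {x l} :
  has_derive A f x l -> f (h + x) @[h --> increments A x] --> f x.
Proof.
move=> fl.
have id0 : (fun h : R => h) @ increments A x --> (0 : R).
  apply: cvg_trans (cvg_within _) _ => //.
  by apply: cvg_trans (cvg_within _) _.
have lim0 : (fun h : R => h *: (h^-1 *: (f (h + x) - f x)) + f x)
    @ increments A x --> 0 *: l + f x.
  by apply: cvgD; [exact: cvgZ|exact: cvg_cst].
rewrite scale0r add0r in lim0.
apply: cvg_trans lim0; apply: near_eq_cvg.
rewrite /increments near_withinE near_withinE; apply: nearW => h /= h0 _.
by rewrite scalerA divff // scale1r subrK.
Qed.

(** In [has_derive_increments] the point [x] itself is excluded; here it is
    included, which gives continuity within [A]. *)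
Lemma has_derive_cvg {V : normedModType R} {A} {f : R -> V} {x l} :
  has_derive A f x l -> f y @[y --> within A (nbhs x)] --> f x.
Proof.
move=> /has_derive_increments fx P Pfx.
have fP := fx _ Pfx.
have {}fP : \forall h \near (0 : R), h != 0 -> A (h + x) -> P (f (h + x)) by [].
have sub0 : (y - x) @[y --> x] --> (0 : R).
  by rewrite -(subrr x); apply: cvgB; [exact: cvg_id|exact: cvg_cst].
have nP : \forall y \near x, y - x != 0 -> A (y - x + x) -> P (f (y - x + x)).
  exact: sub0 _ fP.
have : \forall y \near x, A y -> P (f y).
  apply: filterS nP => y Py Ay.
  case: (eqVneq y x) => [->|yx]; first exact: nbhs_singleton.
  by move: Py; rewrite subrK subr_eq0; apply.
by [].
Qed.

Lemma has_deriveM {A} {f k : R -> R} {x l m} :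
  has_derive A f x l -> has_derive A k x m ->
  has_derive A (fun y => f y * k y) x (l * k x + f x * m).
Proof.
move=> fl km; have kx := has_derive_increments km.
have lim0 : (fun h : R => (h^-1 *: (f (h + x) - f x)) * k (h + x) +
    f x * (h^-1 *: (k (h + x) - k x))) @ increments A x --> l * k x + f x * m.
  by apply: cvgD; [exact: cvgM|apply: cvgM km; exact: cvg_cst].
apply: cvg_trans lim0; apply: near_eq_cvg; apply: nearW => h /=.
rewrite /GRing.scale /=; ring.
Qed.

Lemma cvg_mxP {T : Type} {F : set_system T} {FF : Filter F} {m n : nat}
    {f : T -> 'M[R]_(m, n)} {l : 'M[R]_(m, n)} :
  f @ F --> l <-> forall i j, f x i j @[x --> F] --> l i j.
Proof.
split=> [fl i j|fl].
  apply: (cvg_comp f (fun M : 'M[R]_(m, n) => M i j) fl).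
  exact: coord_continuous.
move=> P [/= Q Ql QP].
have Qf : \forall x \near F, forall i j, Q i j (f x i j).
  apply: filter_forall => i; apply: filter_forall => j.
  exact: (fl i j _ (Ql i j)).
by apply: filterS Qf => x Qx; exact: QP.
Qed.

Lemma has_derive_mxP {m n : nat} {A} {f : R -> 'M[R]_(m, n)} {x l} :
  has_derive A f x l <->
  forall i j, has_derive A (fun y => f y i j) x (l i j).
Proof.
rewrite /has_derive; split=> [/cvg_mxP fl i j|fl].
  have := fl i j; apply: cvg_trans; apply: near_eq_cvg; apply: nearW => h /=.
  by rewrite !mxE.
apply/cvg_mxP => i j; have := fl i j.
apply: cvg_trans; apply: near_eq_cvg; apply: nearW => h /=.
by rewrite !mxE.
Qed.

(** If [y <> x] is another point of the interval, then so is
    [x + c (y - x)] for small [c > 0]: the increments [c (y - x)] are admissible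
    and tend to [0]. *)
Lemma increments_interval_proper I x : is_interval I ->
  (exists a b : R, [/\ I a, I b & a < b]) -> I x ->
  ProperFilter (increments I x).
Proof.
move=> itvI [a [b [Ia Ib ab]]] Ix.
have [y Iy yx] : exists2 y, I y & y != x.
  case: (eqVneq a x) => [ax|]; last by exists a.
  by exists b => //; rewrite -ax gt_eqF.
apply: Build_ProperFilter => F0.
have {}F0 : \forall h \near (0 : R), h != 0 -> I (h + x) -> False by exact: F0.
have mul0 : c * (y - x) @[c --> (0 : R)^'+] --> (0 : R).
  rewrite -[X in _ --> X](mul0r (y - x)); apply: cvgM; last exact: cvg_cst.
  exact: (cvg_within_filter _ (@cvg_id _ _)).
have nF : \forall c \near (0 : R)^'+,
    c * (y - x) != 0 -> I (c * (y - x) + x) -> False by exact: mul0 _ F0.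
near (0 : R)^'+ => c.
have c0 : 0 < c by near: c; exact: nbhs_right_gt.
have c1 : c < 1 by near: c; exact: nbhs_right_lt.
suff Icxy : I (c * (y - x) + x).
  have cxy0 : c * (y - x) != 0 by rewrite mulf_neq0 ?(gt_eqF c0) // subr_eq0.
  by move: cxy0 Icxy; near: c.
have -> : c * (y - x) + x = (1 - c) * x + c * y by ring.
have [xy|xy] := leP x y; [apply: (itvI x y)|apply: (itvI y x)] => //;
  apply/andP; split; nra.
Unshelve. all: by end_near. Qed.

End OneVariable.

(** * Functions with zero derivative on an interval *)

Section Constancy.
Context {R : realType}.

Lemma has_derive_is_derive {V : normedModType R} (A : set R) (f : R -> V)
    (x : R) (l : V) :
  nbhs x A -> has_derive A f x l -> is_derive x (1 : R) f l.
Proof.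
move=> Ax fl.
have Ah : \forall h \near (0 : R), A (h + x).
  have add0 : h + x @[h --> (0 : R)] --> x.
    by rewrite -[X in _ --> X](add0r x); apply: cvgD; [exact: cvg_id|exact: cvg_cst].
  exact: add0 _ Ax.
have fl1 : (fun h : R => h^-1 *: ((f \o shift x) (h *: 1) - f x)) @ 0^' --> l.
  move=> P Pl.
  have {}fl : \forall h \near (0 : R), h != 0 -> A (h + x) ->
      P (h^-1 *: (f (h + x) - f x)) by exact: fl.
  have : \forall h \near (0 : R), h != 0 -> 
      P (h^-1 *: ((f \o shift x) (h *: 1) - f x)).
    apply: filterS2 Ah fl => h hA Ph h0 /=.
    by rewrite /GRing.scale /= mulr1; exact: Ph.
  by [].
apply: DeriveDef; first by apply/cvg_ex; exists l.
exact: cvg_lim.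
Qed.

(** Relative derivatives are ordinary ones at interior points, and give
    continuity up to the endpoints, which is what the mean value theorem
    needs on [[x, y]]. *)
Lemma has_derive0_constant {I : set R} {f : R -> R} :
  is_interval I -> (forall x, I x -> has_derive I f x 0) ->
  forall x y, I x -> I y -> f x = f y.
Proof.
move=> itvI f0 x y; wlog xy : x y / x < y => [wlog_xy Ix Iy|Ix Iy].
  have [xy|yx|->//] := ltgtP x y; first exact: wlog_xy.
  by apply/esym; exact: wlog_xy.
have Isub z : x <= z <= y -> I z by exact: itvI.
have fcont : {within `[x, y], continuous f}.
  apply/subspace_continuousP => z /= /[!in_itv] /= zxy.
  apply: has_derive_cvg (has_derive_subset _ (f0 z (Isub z zxy))) => t /=.
  by rewrite in_itv; exact: Isub.
have fder z : z \in `]x, y[ -> is_derive z (1 : R) f ((fun=> 0) z).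
  rewrite in_itv /= => /andP[xz zy].
  apply: has_derive_is_derive (f0 z _); last by apply: Isub; rewrite !ltW.
  have : \forall t \near z, t \in `]x, y[.
    by apply: near_in_itvoo; rewrite in_itv /= xz.
  by apply: filterS => t; rewrite in_itv /= => /andP[? ?]; apply: Isub; rewrite !ltW.
have [c _] := MVT xy fder fcont.
by rewrite mul0r => /eqP; rewrite subr_eq0 => /eqP.
Qed.

End Constancy.

(** * Partial derivatives and smoothness on a plane set *)

Section PartialDerivatives.
Context {R : realType}.
Implicit Types (A D : set (R * R)) (p : R * R).

Definition slice_s A p : set R := [set s | A (s, p.2)].
Definition slice_t A p : set R := [set t | A (p.1, t)].

Definition has_partial_s {V : normedModType R} A (f : R * R -> V) p (l : V) :=
  has_derive (slice_s A p) (fun s => f (s, p.2)) p.1 l.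

Definition has_partial_t {V : normedModType R} A (f : R * R -> V) p (l : V) :=
  has_derive (slice_t A p) (fun t => f (p.1, t)) p.2 l.

(** No point is isolated in the horizontal or vertical slice through it, so that
    partial derivatives are unique.  This is what rectangles and their relatively
    open subsets have in common. *)
Definition thick A : Prop := forall p, A p ->
  ProperFilter (increments (slice_s A p) p.1) /\
  ProperFilter (increments (slice_t A p) p.2).

Lemma partial_s_val {V : normedModType R} {A} {f : R * R -> V} {p l} :
  thick A -> A p -> has_partial_s A f p l -> partial_s A f p = l.
Proof. by move=> tA /tA[pA _]; exact: has_derive_val. Qed.

Lemma partial_t_val {V : normedModType R} {A} {f : R * R -> V} {p l} :
  thick A -> A p -> has_partial_t A f p l -> partial_t A f p = l.
Proof. by move=> tA /tA[_ pA]; exact: has_derive_val. Qed.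

Lemma has_partial_s_eq_in {V : normedModType R} {A} {f f' : R * R -> V} {p l} :
  (forall x, A x -> f x = f' x) -> A p ->
  has_partial_s A f p l -> has_partial_s A f' p l.
Proof.
move=> ff' Ap; apply: has_derive_eq_in; first by move=> s; exact: ff'.
by rewrite /slice_s /= -surjective_pairing.
Qed.

Lemma has_partial_t_eq_in {V : normedModType R} {A} {f f' : R * R -> V} {p l} :
  (forall x, A x -> f x = f' x) -> A p ->
  has_partial_t A f p l -> has_partial_t A f' p l.
Proof.
move=> ff' Ap; apply: has_derive_eq_in; first by move=> t; exact: ff'.
by rewrite /slice_t /= -surjective_pairing.
Qed.

(** Small increments that keep [p] in [D] keep it in [U], since [U] is the trace
    on [D] of an open set. *)
Lemma thick_relatively_open D (U : set (R * R)) :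
  U `<=` D -> open (U : set (subspace D)) -> thick D -> thick U.
Proof.
move=> UD /open_subspaceP[W oW WU] tD p Up.
have [pDs pDt] := tD p (UD _ Up).
have WpD q : W q -> D q -> U q.
  by move=> Wq Dq; have [] : (U `&` D) q by rewrite -WU.
have nW : \forall q \near p, W q.
  apply: open_nbhs_nbhs; split => //.
  by have [] : (W `&` D) p by rewrite WU; split => //; exact: UD.
have add0 (x : R) : h + x @[h --> (0 : R)] --> x.
  by rewrite -[X in _ --> X](add0r x); apply: cvgD; [exact: cvg_id|exact: cvg_cst].
have to_p1 : (h + p.1, p.2) @[h --> (0 : R)] --> p.
  exact: cvg_pair (add0 p.1) (cvg_cst p.2).
have to_p2 : (p.1, h + p.2) @[h --> (0 : R)] --> p.
  exact: cvg_pair (cvg_cst p.1) (add0 p.2).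
have Ws : \forall h \near (0 : R), W (h + p.1, p.2) by exact: to_p1 _ nW.
have Wt : \forall h \near (0 : R), W (p.1, h + p.2) by exact: to_p2 _ nW.
split; apply: Build_ProperFilter => F0.
  apply: (@filter_not_empty _ _ pDs).
  have {}F0 : \forall h \near (0 : R), h != 0 -> U (h + p.1, p.2) -> False.
    exact: F0.
  have : \forall h \near (0 : R), h != 0 -> D (h + p.1, p.2) -> False.
    by apply: filterS2 F0 Ws => h Fh Wh h0 Dh; apply: Fh => //; exact: WpD.
  by [].
apply: (@filter_not_empty _ _ pDt).
have {}F0 : \forall h \near (0 : R), h != 0 -> U (p.1, h + p.2) -> False.
  exact: F0.
have : \forall h \near (0 : R), h != 0 -> D (p.1, h + p.2) -> False.
  by apply: filterS2 F0 Wt => h Fh Wh h0 Dh; apply: Fh => //; exact: WpD.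
by [].
Qed.

(** The values are prescribed on [A] only: outside [A] partial derivatives may
    be limits along improper filters and have no formula. *)
Record closed_under_partials {V : normedModType R} A
    (C : (R * R -> V) -> Prop) : Prop := ClosedUnderPartials {
  family_continuous : forall f, C f -> {within A, continuous f};
  family_s : forall f, C f -> exists2 k, C k &
    forall p, A p -> has_partial_s A f p (k p);
  family_t : forall f, C f -> exists2 k, C k &
    forall p, A p -> has_partial_t A f p (k p) }.

Arguments family_continuous {V A C} _ {f} _.
Arguments family_s {V A C} _ {f} _.
Arguments family_t {V A C} _ {f} _.

(** By induction on the word, every iterated partial derivative of [f] agrees on
    [A] with a member of the family.  This replaces a study of the individual
    derivatives by the choice of a suitable family. *)
Lemma smooth_on_family {V : normedModType R} {A} {C : (R * R -> V) -> Prop} :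
  thick A -> closed_under_partials A C -> forall f, C f -> smooth_on A f.
Proof.
move=> tA CA f Cf w.
have [k Ck wk] : exists2 k, C k &
    forall p, A p -> iter_partial A w f p = k p.
  elim: w => [|b w [k Ck wk]]; first by exists f.
  have [ks Cks kks] := family_s CA Ck.
  have [kt Ckt kkt] := family_t CA Ck.
  have kw p : A p -> k p = iter_partial A w f p by move=> /wk.
  case: b => /=; [exists kt|exists ks] => // p Ap.
    by apply: partial_t_val => //; apply: has_partial_t_eq_in (kkt p Ap).
  by apply: partial_s_val => //; apply: has_partial_s_eq_in (kks p Ap).
have kw p : A p -> k p = iter_partial A w f p by move=> /wk.
split.
  apply: subspace_eq_continuous (family_continuous CA Ck) => p.
  by rewrite inE => /kw.
have [ks _ kks] := family_s CA Ck.
have [kt _ kkt] := family_t CA Ck.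
move=> p Ap; split.
  exact: has_derive_ex (has_partial_s_eq_in kw Ap (kks p Ap)).
exact: has_derive_ex (has_partial_t_eq_in kw Ap (kkt p Ap)).
Qed.

Lemma closed_under_partials_mx {m n : nat} {A} {C : (R * R -> R) -> Prop} :
  closed_under_partials A C ->
  closed_under_partials A (fun F : R * R -> 'M[R]_(m, n) =>
    forall i j, C (fun p => F p i j)).
Proof.
move=> CA; split=> F CF.
- apply/subspace_continuousP => p Ap; apply/cvg_mxP => i j.
  by have /subspace_continuousP/(_ p Ap) := family_continuous CA (CF i j).
- have /choice[k Ck] (ij : 'I_m * 'I_n) : exists k, C k /\
      forall p, A p -> has_partial_s A (fun p => F p ij.1 ij.2) p (k p).
    by have [k] := family_s CA (CF ij.1 ij.2); exists k.
  exists (fun p => \matrix_(i, j) k (i, j) p) => [i j|p Ap].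
    rewrite (_ : (fun p => _) = k (i, j)); first by have [] := Ck (i, j).
    by apply/funext => p; rewrite mxE.
  by apply/has_derive_mxP => i j; rewrite mxE; have [_] := Ck (i, j); apply.
- have /choice[k Ck] (ij : 'I_m * 'I_n) : exists k, C k /\
      forall p, A p -> has_partial_t A (fun p => F p ij.1 ij.2) p (k p).
    by have [k] := family_t CA (CF ij.1 ij.2); exists k.
  exists (fun p => \matrix_(i, j) k (i, j) p) => [i j|p Ap].
    rewrite (_ : (fun p => _) = k (i, j)); first by have [] := Ck (i, j).
    by apply/funext => p; rewrite mxE.
  by apply/has_derive_mxP => i j; rewrite mxE; have [_] := Ck (i, j); apply.
Qed.

End PartialDerivatives.

(** * Determinants of plane and space vectors *)

Section PlaneCurves.
Context {R : realType}.
Implicit Types (u v w : 'rV[R]_2) (c : R) (p : R * R).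

Lemma det2E u v : det2 u v = u 0 0 * v 0 1 - u 0 1 * v 0 0.
Proof.
rewrite /det2 (expand_det_row _ 0) !big_ord_recl big_ord0 /cofactor !det_mx11.
rewrite !mxE /= !expr0 !mul1r addr0 /bump /= expr1 mulN1r mulrN.
congr (u _ _ * v _ _ - u _ _ * v _ _); exact/val_inj.
Qed.

Lemma det2C u v : det2 u v = - det2 v u.
Proof. by rewrite !det2E; ring. Qed.

Lemma dot_perp u v : dot (perp u) v = det2 u v.
Proof.
rewrite /dot !big_ord_recl big_ord0 !mxE /= det2E.
rewrite (_ : lift ord0 ord0 = 1); last exact/val_inj.
ring.
Qed.

Lemma has_derive_det2 {A : set R} {f k : R -> 'rV[R]_2} {x : R} {l m} :
  has_derive A f x l -> has_derive A k x m ->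
  has_derive A (fun y => det2 (f y) (k y)) x (det2 l (k x) + det2 (f x) m).
Proof.
move=> /has_derive_mxP fl /has_derive_mxP km.
rewrite (_ : (fun y => _) =
  fun y => f y 0 0 * k y 0 1 + -1 *: (f y 0 1 * k y 0 0)); last first.
  by apply/funext => y; rewrite det2E scaleN1r.
rewrite (_ : _ + _ = (l 0 0 * k x 0 1 + f x 0 0 * m 0 1) +
    -1 *: (l 0 1 * k x 0 0 + f x 0 1 * m 0 0)); last first.
  by rewrite !det2E scaleN1r; ring.
by apply: has_deriveD; [|apply: has_deriveZ]; apply: has_deriveM.
Qed.

Lemma ord2 (j : 'I_2) : j = 0 \/ j = 1.
Proof. by case: j => [[|[|//]] j2]; [left|right]; exact/val_inj. Qed.

Lemma eq_rV2 u v : u 0 0 = v 0 0 -> u 0 1 = v 0 1 -> u = v.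
Proof. by move=> uv0 uv1; apply/rowP => j; have [->|->] := ord2 j. Qed.

(** If the determinant vanishes, [v_i u - u_i v = 0] for both indices [i], so
    injectivity would make both vectors zero; the converse is Cramer's rule. *)
Lemma injective_lincomb u v :
  injective (fun c : R * R => c.1 *: u + c.2 *: v) <-> det2 u v != 0.
Proof.
split=> [inj|duv [a b] [a' b'] /= eq_ab].
  apply/negP => /eqP; rewrite det2E => duv0.
  have uv0 i : v 0 i = 0 /\ u 0 i = 0.
    have : (v 0 i, - u 0 i) = (0, 0) :> R * R.
      apply: inj => /=; rewrite !scale0r addr0.
      by apply: eq_rV2; rewrite !mxE; have [->|->] := ord2 i; lra.
    by case=> -> /eqP; rewrite oppr_eq0 => /eqP.
  have : (1, 0) = (0, 0) :> R * R.
    apply: inj => /=; apply/rowP => i; rewrite !mxE.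
    by have [-> ->] := uv0 i; rewrite !mulr0.
  by case=> /eqP; rewrite oner_eq0.
have cramer_u x y : det2 (x *: u + y *: v) v = x * det2 u v.
  by rewrite !det2E !mxE; ring.
have cramer_v x y : det2 u (x *: u + y *: v) = y * det2 u v.
  by rewrite !det2E !mxE; ring.
congr (_, _); apply: (mulIf duv).
  by rewrite -(cramer_u a b) eq_ab cramer_u.
by rewrite -(cramer_v a b) eq_ab cramer_v.
Qed.

(** A row given by its list of entries, unlike a block matrix, reduces when it is
    evaluated at a numeral index. *)
Definition vec3 (u : 'rV[R]_2) (c : R) : 'rV[R]_3 :=
  \row_(j < 3) [:: u 0 0; u 0 1; c]`_j.

Lemma row_mx_vec3 u c : row_mx u c%:M = vec3 u c :> 'rV[R]_(2 + 1).
Proof.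
apply/rowP => j; rewrite !mxE; case: splitP => i ->.
  by have [->|->] := ord2 i.
by rewrite ord1 mxE eqxx.
Qed.

Lemma det3_vec3 u v w a b c :
  det3 (vec3 u a) (vec3 v b) (vec3 w c) =
  a * det2 v w - b * det2 u w + c * det2 u v.
Proof.
rewrite /det3 (expand_det_row _ 0) !big_ord_recl big_ord0 /cofactor.
rewrite !(expand_det_row _ 0) !big_ord_recl !big_ord0 /cofactor !det_mx11.
rewrite !mxE /= !det2E; ring.
Qed.

Lemma has_derive_vec3 {A : set R} {f : R -> 'rV[R]_2} {k : R -> R} {x : R} {l m} :
  has_derive A f x l -> has_derive A k x m ->
  has_derive A (fun y => vec3 (f y) (k y)) x (vec3 l m).
Proof.
move=> /has_derive_mxP fl km; apply/has_derive_mxP => i j.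
rewrite mxE (_ : (fun y => _) = fun y => [:: f y 0 0; f y 0 1; k y]`_j); last first.
  by apply/funext => y; rewrite mxE.
by case: j => [[|[|[|//]]] j3]; [exact: (fl 0 0)|exact: (fl 0 1)|exact: km].
Qed.

End PlaneCurves.

(** * The generalized area distance *)

Section AreaDistance.
Context {R : realType} {I1 I2 : set R}.
Hypotheses (intervalI1 : is_interval I1) (intervalI2 : is_interval I2).
Hypothesis nondegI1 : exists a b : R, [/\ I1 a, I1 b & a < b].
Hypothesis nondegI2 : exists a b : R, [/\ I2 a, I2 b & a < b].
Context {alpha beta : R -> 'rV[R]_2}.
Hypotheses (smooth_alpha : smooth_curve I1 alpha)
  (smooth_beta : smooth_curve I2 beta).
Context {g : R * R -> R}.
Hypothesis grad_g : has_gradient_half_chord (I1 `*` I2) alpha beta g.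
Implicit Types (A : set (R * R)) (p : R * R) (n : nat).

Local Notation D := (I1 `*` I2).
Local Notation "'alpha^(' n )" := (iter n (derive1_within I1) alpha)
  (at level 0, format "'alpha^(' n )").
Local Notation "'beta^(' n )" := (iter n (derive1_within I2) beta)
  (at level 0, format "'beta^(' n )").

Lemma thick_rectangle : thick D.
Proof.
move=> [s t] [/= Is It]; split.
  rewrite (_ : slice_s _ _ = I1); first exact: increments_interval_proper.
  by apply/seteqP; split=> x /= => [[]|].
rewrite (_ : slice_t _ _ = I2); first exact: increments_interval_proper.
by apply/seteqP; split=> x /= => [[]|].
Qed.

Lemma alpha_s {A} n {p} : A `<=` D -> A p ->
  has_partial_s A (fun p => alpha^(n) p.1) p (alpha^(n.+1) p.1).
Proof.
move=> AD /AD[/= Is _].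
apply: has_derive_subset (smooth_curve_has_derive n smooth_alpha Is).
by move=> s /AD[].
Qed.

Lemma alpha_t A n p : has_partial_t A (fun p => alpha^(n) p.1) p 0.
Proof. exact: (has_derive_cst _ (alpha^(n) p.1)). Qed.

Lemma beta_s A n p : has_partial_s A (fun p => beta^(n) p.2) p 0.
Proof. exact: (has_derive_cst _ (beta^(n) p.2)). Qed.

Lemma beta_t {A} n {p} : A `<=` D -> A p ->
  has_partial_t A (fun p => beta^(n) p.2) p (beta^(n.+1) p.2).
Proof.
move=> AD /AD[/= _ It].
apply: has_derive_subset (smooth_curve_has_derive n smooth_beta It).
by move=> t /AD[].
Qed.

Lemma midpoint_s {A p} : A `<=` D -> A p ->
  has_partial_s A (midpoint alpha beta) p (2^-1 *: alpha^(1) p.1).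
Proof.
move=> AD Ap; rewrite -[alpha^(1) _]addr0; apply: has_deriveZ.
exact: (has_deriveD (f := alpha) (k := fun=> beta p.2)
  (alpha_s 0 AD Ap) (beta_s A 0 p)).
Qed.

Lemma midpoint_t {A p} : A `<=` D -> A p ->
  has_partial_t A (midpoint alpha beta) p (2^-1 *: beta^(1) p.2).
Proof.
move=> AD Ap; rewrite -[beta^(1) _]add0r; apply: has_deriveZ.
exact: (has_deriveD (f := fun=> alpha p.1) (k := beta)
  (alpha_t A 0 p) (beta_t 0 AD Ap)).
Qed.

Definition chord p : 'rV[R]_2 := beta p.2 - alpha p.1.

Lemma chord_s {A p} : A `<=` D -> A p ->
  has_partial_s A chord p (- alpha^(1) p.1).
Proof.
move=> AD Ap.
rewrite (_ : - _ = 0 + -1 *: alpha^(1) p.1); last by rewrite add0r scaleN1r.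
rewrite /has_partial_s (_ : (fun s => _) = fun s => beta p.2 + -1 *: alpha s).
  exact: has_deriveD (beta_s A 0 p) (has_deriveZ (f := alpha) _ (alpha_s 0 AD Ap)).
by apply/funext => s; rewrite scaleN1r.
Qed.

Lemma chord_t {A p} : A `<=` D -> A p ->
  has_partial_t A chord p (beta^(1) p.2).
Proof.
move=> AD Ap; rewrite -[beta^(1) _]addr0.
exact: (has_deriveD (f := beta) (beta_t 0 AD Ap) (has_derive_cst _ (- alpha p.1) _)).
Qed.

(** Rotation turns the inner product into a determinant; the factor [4^-1]
    collects the halves of the normal and of the derivative of the midpoint. *)
Lemma half_chord_dot p u :
  dot (half_chord_perp alpha beta p) (2^-1 *: u) = 4^-1 * det2 (chord p) u.
Proof.
rewrite /half_chord_perp (_ : _ *: _ = perp (2^-1 *: chord p)).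
  by rewrite dot_perp !det2E !mxE; field.
by apply/rowP => j; rewrite !mxE; have [->|->] := ord2 j; rewrite /= ?mulrN.
Qed.

Lemma g_s {A p} : A `<=` D -> A p ->
  has_partial_s A g p (4^-1 * det2 (chord p) (alpha^(1) p.1)).
Proof.
move=> AD Ap; have Dp := AD _ Ap; have [gs vs _ _] := grad_g p Dp.
rewrite -half_chord_dot.
rewrite -(partial_s_val thick_rectangle Dp (midpoint_s (@subset_refl _ D) Dp)) //.
rewrite -vs; apply: has_derive_subset gs => s; exact: AD.
Qed.

Lemma g_t {A p} : A `<=` D -> A p ->
  has_partial_t A g p (4^-1 * det2 (chord p) (beta^(1) p.2)).
Proof.
move=> AD Ap; have Dp := AD _ Ap; have [_ _ gt vt] := grad_g p Dp.
rewrite -half_chord_dot.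
rewrite -(partial_t_val thick_rectangle Dp (midpoint_t (@subset_refl _ D) Dp)) //.
rewrite -vt; apply: has_derive_subset gt => t; exact: AD.
Qed.

(** Since [g_s = 4^-1 [beta - alpha, alpha']], the [s]-derivative of
    [g (s, t) - g (s, t0)] is [4^-1 [beta t - beta t0, alpha' s]], the derivative
    of [4^-1 [beta t - beta t0, alpha s]]; the difference of the two is constant
    in [s].  This expresses [g] through its restrictions to two lines and through
    the curves. *)
Lemma g_mixed_difference {s s0 t t0} : I1 s -> I1 s0 -> I2 t -> I2 t0 ->
  g (s, t) = g (s, t0) + g (s0, t) - g (s0, t0) +
    4^-1 * det2 (beta t - beta t0) (alpha s - alpha s0).
Proof.
move=> Is Is0 It It0.
pose k x := g (x, t) + -1 *: g (x, t0) +
  - 4^-1 *: det2 (beta t - beta t0) (alpha x).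
have slice_I1 y : I2 y -> I1 `<=` slice_s D (s, y).
  by move=> Iy x Ix; split.
have k0 x : I1 x -> has_derive I1 k x 0.
  move=> Ix.
  have gxy y : I2 y -> has_derive I1 (fun x => g (x, y)) x
      (4^-1 * det2 (chord (x, y)) (alpha^(1) x)).
    move=> Iy; apply: has_derive_subset (slice_I1 y Iy) _.
    exact: (g_s (p := (x, y))).
  apply: has_derive_eq.
    exact: (has_deriveD (has_deriveD (gxy t It) (has_deriveZ (-1) (gxy t0 It0)))
      (has_deriveZ (- 4^-1) (has_derive_det2
        (has_derive_cst _ (beta t - beta t0) _)
        (smooth_curve_has_derive 0 smooth_alpha Ix)))).
  by rewrite /GRing.scale /= !det2E /chord !mxE /=; ring.
have := has_derive0_constant intervalI1 k0 _ _ Is Is0.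
rewrite /k /GRing.scale /= !det2E !mxE => kss0; lra.
Qed.

Lemma cvg_fst_within {A p} : A `<=` D ->
  x.1 @[x --> within A (nbhs p)] --> within I1 (nbhs p.1).
Proof.
move=> AD P IP.
have {}IP : \forall s \near p.1, I1 s -> P s by exact: IP.
have nP : \forall x \near p, I1 x.1 -> P x.1.
  exact: (@cvg_fst _ _ (nbhs p.1) (nbhs p.2) _ _ IP).
have : \forall x \near p, A x -> P x.1.
  by apply: filterS nP => x Px /AD[Ix1 Ix2]; exact: Px.
by [].
Qed.

Lemma cvg_snd_within {A p} : A `<=` D ->
  x.2 @[x --> within A (nbhs p)] --> within I2 (nbhs p.2).
Proof.
move=> AD P IP.
have {}IP : \forall s \near p.2, I2 s -> P s by exact: IP.
have nP : \forall x \near p, I2 x.2 -> P x.2.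
  exact: (@cvg_snd _ _ (nbhs p.1) (nbhs p.2) _ _ IP).
have : \forall x \near p, A x -> P x.2.
  by apply: filterS nP => x Px /AD[Ix1 Ix2]; exact: Px.
by [].
Qed.

Lemma alpha_cvg {A} n {p} : A `<=` D -> A p ->
  alpha^(n) x.1 @[x --> within A (nbhs p)] --> alpha^(n) p.1.
Proof.
move=> AD Ap; have [Is _] := AD _ Ap.
exact: (cvg_comp _ _ (cvg_fst_within (p := p) AD)
  (has_derive_cvg (smooth_curve_has_derive n smooth_alpha Is))).
Qed.

Lemma beta_cvg {A} n {p} : A `<=` D -> A p ->
  beta^(n) x.2 @[x --> within A (nbhs p)] --> beta^(n) p.2.
Proof.
move=> AD Ap; have [_ It] := AD _ Ap.
exact: (cvg_comp _ _ (cvg_snd_within (p := p) AD)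
  (has_derive_cvg (smooth_curve_has_derive n smooth_beta It))).
Qed.

Lemma cvg_det2 {T : Type} {F : set_system T} {FF : Filter F}
    {f k : T -> 'rV[R]_2} {l m : 'rV[R]_2} :
  f @ F --> l -> k @ F --> m -> det2 (f x) (k x) @[x --> F] --> det2 l m.
Proof.
move=> /cvg_mxP fl /cvg_mxP km; rewrite det2E.
under eq_fun do rewrite det2E.
by apply: cvgB; apply: cvgM.
Qed.

(** Existence of partial derivatives does not give joint continuity.  Around [p],
    [g_mixed_difference] writes [g] as a sum of functions of one variable and a
    determinant in the curves, each of which is continuous. *)
Lemma g_continuous {A} : A `<=` D -> {within A, continuous g}.
Proof.
move=> AD; apply/subspace_continuousP => p Ap; have Dp := AD _ Ap.
have [Is It] := Dp.
have gs : g (x, p.2) @[x --> within I1 (nbhs p.1)] --> g p.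
  rewrite [p in g p]surjective_pairing.
  apply: has_derive_cvg (has_derive_subset _ (g_s (@subset_refl _ D) Dp)).
  by move=> x Ix; split.
have gt : g (p.1, x) @[x --> within I2 (nbhs p.2)] --> g p.
  rewrite [p in g p]surjective_pairing.
  apply: has_derive_cvg (has_derive_subset _ (g_t (@subset_refl _ D) Dp)).
  by move=> x Ix; split.
have lim_g : g (x.1, p.2) + g (p.1, x.2) - g p +
      4^-1 * det2 (beta x.2 - beta p.2) (alpha x.1 - alpha p.1)
    @[x --> within A (nbhs p)] --> g p + g p - g p +
      4^-1 * det2 (beta p.2 - beta p.2) (alpha p.1 - alpha p.1).
  apply: cvgD; [apply: cvgB; [apply: cvgD|exact: cvg_cst]|].
  - exact: (cvg_comp _ _ (cvg_fst_within (p := p) AD) gs).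
  - exact: (cvg_comp _ _ (cvg_snd_within (p := p) AD) gt).
  - apply: cvgM; first exact: cvg_cst.
    by apply: cvg_det2; apply: cvgB;
      [exact: (beta_cvg 0)|exact: cvg_cst|exact: (alpha_cvg 0)|exact: cvg_cst].
rewrite (_ : _ + _ = g p) in lim_g; last by rewrite !subrr det2E !mxE; ring.
apply: cvg_trans lim_g; apply: near_eq_cvg; rewrite near_withinE.
apply: nearW => x /AD[Ix1 Ix2].
rewrite /from_subspace; have := g_mixed_difference Ix1 Is Ix2 It.
by rewrite -!surjective_pairing => ->.
Qed.


(** The polynomials in [g] and in the coordinates of all derivatives of the two
    curves: a family that contains [g] and all functions met below, and is closed
    under partial derivatives because [g_s] and [g_t] no longer involve [g]. *)
Inductive polynomial_jet : (R * R -> R) -> Prop :=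
| jet_cst c : polynomial_jet (fun=> c)
| jet_alpha n j : polynomial_jet (fun p => alpha^(n) p.1 0 j)
| jet_beta n j : polynomial_jet (fun p => beta^(n) p.2 0 j)
| jet_g : polynomial_jet g
| jetD f k : polynomial_jet f -> polynomial_jet k ->
    polynomial_jet (fun p => f p + k p)
| jetM f k : polynomial_jet f -> polynomial_jet k ->
    polynomial_jet (fun p => f p * k p).

Lemma jet_det2 {u v : R * R -> 'rV[R]_2} :
  (forall j, polynomial_jet (fun p => u p 0 j)) ->
  (forall j, polynomial_jet (fun p => v p 0 j)) ->
  polynomial_jet (fun p => det2 (u p) (v p)).
Proof.
move=> ju jv; rewrite (_ : (fun p => _) =
    fun p => u p 0 0 * v p 0 1 + -1 * (u p 0 1 * v p 0 0)); last first.
  by apply/funext => p; rewrite det2E mulN1r.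
by apply: jetD; [|apply: jetM; [exact: jet_cst|]]; apply: jetM.
Qed.

Lemma jet_chord j : polynomial_jet (fun p => chord p 0 j).
Proof.
rewrite (_ : (fun p => _) = fun p => beta p.2 0 j + -1 * alpha p.1 0 j).
  apply: jetD; first exact: (jet_beta 0).
  by apply: jetM; [exact: jet_cst|exact: (jet_alpha 0)].
by apply/funext => p; rewrite !mxE mulN1r.
Qed.

Lemma jet_closed_under_partials {A} : A `<=` D ->
  closed_under_partials A polynomial_jet.
Proof.
move=> AD; split.
- move=> f; elim=> {f} [c|n j|n j||f k _ cf _ ck|f k _ cf _ ck].
  + by apply/subspace_continuousP => p _; exact: cvg_cst.
  + apply/subspace_continuousP => p Ap.
    exact: (cvg_mxP.1 (alpha_cvg n AD Ap) 0 j).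
  + apply/subspace_continuousP => p Ap.
    exact: (cvg_mxP.1 (beta_cvg n AD Ap) 0 j).
  + exact: g_continuous.
  + apply/subspace_continuousP => p Ap; apply: cvgD.
      exact: (subspace_continuousP _ _).1 cf p Ap.
    exact: (subspace_continuousP _ _).1 ck p Ap.
  + apply/subspace_continuousP => p Ap; apply: cvgM.
      exact: (subspace_continuousP _ _).1 cf p Ap.
    exact: (subspace_continuousP _ _).1 ck p Ap.
- move=> f; elim=> {f} [c|n j|n j||f k jf [f' jf' ff'] jk [k' jk' kk']
    |f k jf [f' jf' ff'] jk [k' jk' kk']].
  + by exists (fun=> 0) => [|p _]; [exact: jet_cst|exact: has_derive_cst].
  + exists (fun p => alpha^(n.+1) p.1 0 j) => [|p Ap]; first exact: jet_alpha.
    exact: (has_derive_mxP.1 (alpha_s n AD Ap) 0 j).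
  + exists (fun=> 0) => [|p _]; first exact: jet_cst.
    exact: (has_derive_cst _ (beta^(n) p.2 0 j)).
  + exists (fun p => 4^-1 * det2 (chord p) (alpha^(1) p.1)) => [|p Ap].
      apply: jetM; first exact: jet_cst.
      by apply: jet_det2 => [|j]; [exact: jet_chord|exact: (jet_alpha 1)].
    exact: g_s AD Ap.
  + exists (fun p => f' p + k' p) => [|p Ap]; first exact: jetD.
    exact: has_deriveD (ff' p Ap) (kk' p Ap).
  + exists (fun p => f' p * k p + f p * k' p) => [|p Ap].
      by apply: jetD; apply: jetM.
    have := has_deriveM (ff' p Ap) (kk' p Ap).
    by rewrite -surjective_pairing.
- move=> f; elim=> {f} [c|n j|n j||f k jf [f' jf' ff'] jk [k' jk' kk']
    |f k jf [f' jf' ff'] jk [k' jk' kk']].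
  + by exists (fun=> 0) => [|p _]; [exact: jet_cst|exact: has_derive_cst].
  + exists (fun=> 0) => [|p _]; first exact: jet_cst.
    exact: (has_derive_cst _ (alpha^(n) p.1 0 j)).
  + exists (fun p => beta^(n.+1) p.2 0 j) => [|p Ap]; first exact: jet_beta.
    exact: (has_derive_mxP.1 (beta_t n AD Ap) 0 j).
  + exists (fun p => 4^-1 * det2 (chord p) (beta^(1) p.2)) => [|p Ap].
      apply: jetM; first exact: jet_cst.
      by apply: jet_det2 => [|j]; [exact: jet_chord|exact: (jet_beta 1)].
    exact: g_t AD Ap.
  + exists (fun p => f' p + k' p) => [|p Ap]; first exact: jetD.
    exact: has_deriveD (ff' p Ap) (kk' p Ap).
  + exists (fun p => f' p * k p + f p * k' p) => [|p Ap].
      by apply: jetD; apply: jetM.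
    have := has_deriveM (ff' p Ap) (kk' p Ap).
    by rewrite -surjective_pairing.
Qed.

Local Notation q := (area_distance alpha beta g).

Lemma area_distanceE p : q p = vec3 (midpoint alpha beta p) (g p).
Proof. exact: row_mx_vec3. Qed.

Lemma area_distance_smooth {A} : A `<=` D -> thick A -> smooth_on A q.
Proof.
move=> AD tA.
apply: (smooth_on_family tA (closed_under_partials_mx (jet_closed_under_partials AD))).
move=> i j; rewrite ord1.
have jm k : polynomial_jet (fun p => midpoint alpha beta p 0 k).
  rewrite (_ : (fun p => _) = fun p => 2^-1 * (alpha p.1 0 k + beta p.2 0 k)).
    apply: jetM; first exact: jet_cst.
    by apply: jetD; [exact: (jet_alpha 0)|exact: (jet_beta 0)].
  by apply/funext => p; rewrite !mxE.
rewrite (_ : (fun p => _) = fun p =>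
    [:: midpoint alpha beta p 0 0; midpoint alpha beta p 0 1; g p]`_j).
  by case: j => [[|[|[|//]]] j3]; [exact: jm|exact: jm|exact: jet_g].
by apply/funext => p; rewrite area_distanceE mxE.
Qed.

(** The vector [(w, n . w)] with [w = u / 2], where [n] is the half chord at [p],
    rotated: as [grad g = n], the tangent plane at [p] is the graph of
    [w |-> n . w], and all these vectors lie in it. *)
Definition tangent p (u : 'rV[R]_2) : 'rV[R]_3 :=
  vec3 (2^-1 *: u) (4^-1 * det2 (chord p) u).

Lemma tangent_lincomb p u v (x y : R) :
  x *: tangent p u + y *: tangent p v = tangent p (x *: u + y *: v).
Proof.
apply/rowP => j; rewrite !mxE !det2E !mxE.
by case: j => [[|[|[|//]]] j3] /=; ring.
Qed.

Lemma tangent_inj p : injective (tangent p).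
Proof.
move=> u v /rowP uv; have half : (2 : R)^-1 != 0 by rewrite invr_eq0 pnatr_eq0.
apply: eq_rV2; apply: (mulfI half).
  by have := uv 0; rewrite !mxE.
by have := uv 1; rewrite !mxE.
Qed.

(** The three vectors lie in a plane. *)
Lemma det3_tangent p u v w : det3 (tangent p u) (tangent p v) (tangent p w) = 0.
Proof. by rewrite det3_vec3 !det2E !mxE; ring. Qed.

Lemma det3_tangent_vertical p u v c :
  det3 (tangent p u) (tangent p v) (c *: vec001 R) = 4^-1 * c * det2 u v.
Proof.
rewrite (_ : c *: _ = vec3 0 c); first by rewrite det3_vec3 !det2E !mxE; field.
apply/rowP => j; rewrite !mxE.
by case: j => [[|[|[|//]]] j3] /=; rewrite ?mulr0 ?mulr1.
Qed.

Section Values.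
Context {A : set (R * R)}.
Hypotheses (AD : A `<=` D) (thickA : thick A).

Lemma q_s {p} : A p -> partial_s A q p = tangent p (alpha^(1) p.1).
Proof.
move=> Ap; apply: (partial_s_val thickA Ap).
have := has_derive_vec3 (midpoint_s AD Ap) (g_s AD Ap).
by rewrite (funext area_distanceE).
Qed.

Lemma q_t {p} : A p -> partial_t A q p = tangent p (beta^(1) p.2).
Proof.
move=> Ap; apply: (partial_t_val thickA Ap).
have := has_derive_vec3 (midpoint_t AD Ap) (g_t AD Ap).
by rewrite (funext area_distanceE).
Qed.

(** The derivative of [n] in [s] is orthogonal to [alpha'], so [q_ss] is again
    in the tangent plane. *)
Lemma q_ss {p} : A p ->
  partial_s A (partial_s A q) p = tangent p (alpha^(2) p.1).
Proof.
move=> Ap; apply: (partial_s_val thickA Ap).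
apply: (has_partial_s_eq_in (f := fun p => tangent p (alpha^(1) p.1))) => //.
  by move=> x Ax; rewrite q_s.
apply: has_derive_eq.
  apply: has_derive_vec3; first exact: has_deriveZ (alpha_s 1 AD Ap).
  exact: (has_deriveZ 4^-1 (has_derive_det2 (chord_s AD Ap) (alpha_s 1 AD Ap))).
congr vec3; rewrite /GRing.scale /= !det2E !mxE /=; ring.
Qed.

Lemma q_tt {p} : A p ->
  partial_t A (partial_t A q) p = tangent p (beta^(2) p.2).
Proof.
move=> Ap; apply: (partial_t_val thickA Ap).
apply: (has_partial_t_eq_in (f := fun p => tangent p (beta^(1) p.2))) => //.
  by move=> x Ax; rewrite q_t.
apply: has_derive_eq.
  apply: has_derive_vec3; first exact: has_deriveZ (beta_t 1 AD Ap).
  exact: (has_deriveZ 4^-1 (has_derive_det2 (chord_t AD Ap) (beta_t 1 AD Ap))).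
congr vec3; rewrite /GRing.scale /= !det2E /=; ring.
Qed.

(** The midpoint is a sum of a function of [s] and one of [t], so the first two
    coordinates of the mixed derivative vanish. *)
Lemma q_st {p} : A p -> partial_t A (partial_s A q) p =
  (4^-1 * det2 (beta^(1) p.2) (alpha^(1) p.1)) *: vec001 R.
Proof.
move=> Ap; apply: (partial_t_val thickA Ap).
apply: (has_partial_t_eq_in (f := fun p => tangent p (alpha^(1) p.1))) => //.
  by move=> x Ax; rewrite q_s.
apply: has_derive_eq.
  apply: has_derive_vec3; first exact: has_deriveZ (alpha_t A 1 p).
  exact: (has_deriveZ 4^-1 (has_derive_det2 (chord_t AD Ap) (alpha_t A 1 p))).
apply/rowP => j; rewrite /GRing.scale !det2E !mxE.
by case: j => [[|[|[|//]]] j3] /=; ring.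
Qed.

Lemma area_distance_immersionP {p} : A p ->
  immersion_at A q p <-> det2 (alpha^(1) p.1) (beta^(1) p.2) != 0.
Proof.
move=> Ap; rewrite -injective_lincomb /immersion_at (q_s Ap) (q_t Ap).
split=> inj x y /= xy; apply: inj => /=.
  by rewrite !tangent_lincomb xy.
by move: xy; rewrite !tangent_lincomb => /tangent_inj.
Qed.

Lemma coefL0 {p} : A p -> coefL A q p = 0.
Proof. by move=> Ap; rewrite /coefL q_s // q_t // q_ss // det3_tangent. Qed.

Lemma coefN0 {p} : A p -> Defs.coefN A q p = 0.
Proof. by move=> Ap; rewrite /Defs.coefN q_s // q_t // q_tt // det3_tangent. Qed.

(** [q_st] is [c] times the vertical vector with
    [c = 4^-1 [beta', alpha']], and the determinant of [q_s], [q_t] and the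
    vertical vector is that of the midpoint's derivatives, which is [- c]. *)
Lemma coefM_square {p} : A p ->
  Defs.coefM A q p = - (4^-1 * det2 (beta^(1) p.2) (alpha^(1) p.1)) ^+ 2.
Proof.
move=> Ap; rewrite /Defs.coefM q_s // q_t // q_st // det3_tangent_vertical !det2E.
ring.
Qed.

End Values.

Local Notation U := (regular_set I1 I2 alpha beta).

Lemma regular_set_sub : U `<=` D. Proof. by move=> p []. Qed.

Lemma regular_set_open : open (U : set (subspace D)).
Proof.
have jd : polynomial_jet (fun p => det2 (alpha^(1) p.1) (beta^(1) p.2)).
  by apply: jet_det2 => j; [exact: (jet_alpha 1)|exact: (jet_beta 1)].
have /continuousP cd := family_continuous _ _
  (jet_closed_under_partials (@subset_refl _ D)) _ jd.
have := cd _ (@open_neq R 0); rewrite -open_subspaceTI.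
by congr open.
Qed.

Lemma regular_set_thick : thick U.
Proof.
exact: thick_relatively_open regular_set_sub regular_set_open thick_rectangle.
Qed.

Lemma area_distance_asymptotic : asymptotic_on U q.
Proof.
move=> p Up; split.
  exact: (coefL0 regular_set_sub regular_set_thick Up).
exact: (coefN0 regular_set_sub regular_set_thick Up).
Qed.

Lemma coefM_neq0 p : U p -> 4^-1 * det2 (beta^(1) p.2) (alpha^(1) p.1) != 0.
Proof.
move=> [_ d0]; have {}d0 : det2 (alpha^(1) p.1) (beta^(1) p.2) != 0 by exact: d0.
apply: mulf_neq0; first by rewrite invr_eq0 pnatr_eq0.
by rewrite det2C oppr_eq0.
Qed.

Lemma area_distance_indefinite : indefinite_on U q.
Proof.
move=> p Up; have [-> _] := area_distance_asymptotic p Up.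
rewrite mul0r sub0r oppr_lt0 (coefM_square regular_set_sub regular_set_thick Up).
by rewrite exprn_even_gt0 // oppr_eq0 sqrf_eq0; exact: coefM_neq0.
Qed.

(** The root [4^-1 [beta', alpha']] of the absolute value of [M] is the factor of
    the vertical vector in [q_st]; the other root would give the opposite
    normal. *)
Lemma area_distance_affine_normal : affine_normal U q (fun=> vec001 R).
Proof.
exists (fun p => 4^-1 * det2 (beta^(1) p.2) (alpha^(1) p.1)); split.
  apply: (smooth_on_family regular_set_thick
    (jet_closed_under_partials regular_set_sub)).
  apply: jetM; first exact: jet_cst.
  by apply: jet_det2 => j; [exact: (jet_beta 1)|exact: (jet_alpha 1)].
move=> p Up; rewrite (coefM_square regular_set_sub regular_set_thick Up).
rewrite (q_st regular_set_sub regular_set_thick Up) normrN ger0_norm ?sqr_ge0 //.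
by rewrite scalerA mulVf ?scale1r //; exact: coefM_neq0.
Qed.

Lemma area_distance_immersion_on : immersion_on U q.
Proof.
split; first exact: area_distance_smooth regular_set_sub regular_set_thick.
move=> p Up.
by apply/(area_distance_immersionP regular_set_sub regular_set_thick Up); case: Up.
Qed.

End AreaDistance.

(** * The theorem *)

Theorem mainTheorem1 (R : realType) (I1 I2 : set R)
    (intervalI1 : is_interval I1) (intervalI2 : is_interval I2)
    (nondegI1 : exists a b : R, [/\ I1 a, I1 b & a < b])
    (nondegI2 : exists a b : R, [/\ I2 a, I2 b & a < b])
    (alpha beta : R -> 'rV[R]_2)
    (smooth_alpha : smooth_curve I1 alpha)
    (smooth_beta : smooth_curve I2 beta)
    (g : R * R -> R)
    (grad_g : has_gradient_half_chord (I1 `*` I2) alpha beta g) :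
  let q := area_distance alpha beta g in
  let U := regular_set I1 I2 alpha beta in
  (forall s t : R, I1 s -> I2 t ->
     (~ immersion_at (I1 `*` I2) q (s, t) <->
      det2 (derive1_within I1 alpha s) (derive1_within I2 beta t) = 0)) /\
  open (U : set (subspace (I1 `*` I2))) /\
  improper_indefinite_affine_sphere U q /\
  asymptotic_on U q /\
  indefinite_on U q /\
  affine_normal U q (fun=> vec001 R).
Proof.
move=> q U.
have immD := area_distance_immersionP intervalI1 intervalI2 nondegI1 nondegI2
  smooth_alpha smooth_beta grad_g (@subset_refl _ _)
  (thick_rectangle intervalI1 intervalI2 nondegI1 nondegI2).
have U_open := regular_set_open intervalI1 intervalI2 nondegI1 nondegI2
  smooth_alpha smooth_beta grad_g.
have q_asymptotic := area_distance_asymptotic intervalI1 intervalI2 nondegI1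
  nondegI2 smooth_alpha smooth_beta grad_g.
have q_indefinite := area_distance_indefinite intervalI1 intervalI2 nondegI1
  nondegI2 smooth_alpha smooth_beta grad_g.
have q_normal := area_distance_affine_normal intervalI1 intervalI2 nondegI1
  nondegI2 smooth_alpha smooth_beta grad_g.
have q_immersion := area_distance_immersion_on intervalI1 intervalI2 nondegI1
  nondegI2 smooth_alpha smooth_beta grad_g.
split.
  move=> s t Is It; have imm_st := immD (s, t) (conj Is It).
  split=> [not_imm|det0 /imm_st.1 /negP]; last by apply; apply/eqP.
  by apply/eqP/negPn/negP => /imm_st.2.
have q_sphere : improper_indefinite_affine_sphere U q.
  by split=> //; exists (vec001 R).
exact: (conj U_open (conj q_sphere (conj q_asymptotic (conj q_indefinite q_normal)))).
Qed.
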